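(* There is an algorithm that, given a finite family $\mathcal B$ of finite sets, determines in time $O(nm)$ whether $\mathcal B$ is the base of a learning space, where $n$ is the number of sets in $\mathcal B$ and $m$ is the sum of the cardinalities of the sets in $\mathcal B$.
   Context: All sets and families are finite. For finite sets $P,Q$ let $d(P,Q)=|P\bigtriangleup Q|$. A tight path in a family $\mathcal F$ between distinct $P,Q\in\mathcal F$ is a sequence $P_0=P,P_1,\ldots,P_n=Q$ of members of $\mathcal F$ with $d(P,Q)=n$ and $d(P_i,P_{i+1})=1$ for $0\le i\le n-1$. The family $\mathcal F$ is well-graded if there is a tight path in $\mathcal F$ between any two of its distinct sets. $\mathcal F$ is $\cup$-closed if $\cup\mathcal G\in\mathcal F$ for every nonempty $\mathcal G\subseteq\mathcal F$. A learning space is a well-graded $\cup$-closed family containing the empty set. The span of a family $\mathcal G$ is the family of all unions of nonempty subfamilies of $\mathcal G$. A base of a $\cup$-closed family $\mathcal F$ is a subfamily of $\mathcal F$ whose span is $\mathcal F$ and which is minimal under inclusion with this property. Model of computation: standard random-access machine, with simple arithmetic steps and memory accesses in constant time. Each set element is an object of constant storage with which further information can be associated (e.g. elements are integers $0,1,2,\ldots$ usable as array indices); a set is given as a list of its elements and a family of sets as a list of such lists. Running times are worst case. *)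

(* Defs.v *)
From HB Require Import structures.
From mathcomp Require Import all_boot.
From mathcomp Require Import finmap.

Set Implicit Arguments.
Unset Strict Implicit.
Unset Printing Implicit Defensive.

Local Open Scope fset_scope.

Section LearningSpaces.

Variable K : choiceType.
Implicit Types (P Q : {fset K}) (B F G : {fset {fset K}}).

Definition set_dist P Q : nat := #|` (P `\` Q) `|` (Q `\` P)|.

(* The path is P :: ps, so it makes (size ps) unit steps. *)
Definition tight_path F P Q (ps : seq {fset K}) : Prop :=
  [/\ {subset P :: ps <= F},
      last P ps = Q,
      size ps = set_dist P Q
    & path (fun X Y => set_dist X Y == 1) P ps].

Definition well_graded F : Prop :=
  forall P Q, P \in F -> Q \in F -> P != Q -> exists ps, tight_path F P Q ps.

Definition union_closed F : Prop :=
  forall G, G `<=` F -> G != fset0 -> fcover G \in F.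

Definition learning_space F : Prop :=
  [/\ well_graded F, union_closed F & fset0 \in F].

(* Only nonempty subfamilies are used: fset0 is in the span of G only if it is
   already a member of G. *)
Definition family_span G : {fset {fset K}} :=
  [fset fcover H | H in fpowerset G & H != fset0].

Definition is_base B F : Prop :=
  [/\ B `<=` F,
      family_span B = F
    & forall G, G `<=` F -> family_span G = F -> G `<=` B -> G = B].

(* union_closed F is part of learning_space F. *)
Definition base_of_learning_space B : Prop :=
  exists2 F, learning_space F & is_base B F.

End LearningSpaces.

(* A random-access machine with natural-number contents, a finite program, and
   unit cost per instruction. A program names finitely many registers; only the
   memory can be addressed indirectly. There is no multiplication, shift or
   bitwise instruction, and subtraction is truncated at 0. *)
Inductive instr : Type :=
| Const of nat & nat        (* r_d := k *)
| Add of nat & nat & nat    (* r_d := r_a + r_b *)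
| Sub of nat & nat & nat    (* r_d := r_a - r_b *)
| Read of nat & nat         (* r_d := mem[r_a] *)
| Write of nat & nat        (* mem[r_a] := r_s *)
| Jump of nat               (* goto l *)
| Jzero of nat & nat        (* if r_a = 0 then goto l *)
| Halt.

Definition program := seq instr.

Record config := Config { pc : nat; reg : nat -> nat; mem : nat -> nat }.

Definition upd (f : nat -> nat) (a v : nat) : nat -> nat :=
  fun i => if i == a then v else f i.

(* Leaving the program text also halts. *)
Definition current (p : program) (c : config) : instr := nth Halt p (pc c).

Definition step (p : program) (c : config) : config :=
  let: Config i r m := c in
  match current p c with
  | Const d k => Config i.+1 (upd r d k) m
  | Add d a b => Config i.+1 (upd r d (r a + r b)) m
  | Sub d a b => Config i.+1 (upd r d (r a - r b)) m
  | Read d a  => Config i.+1 (upd r d (m (r a))) m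
  | Write a s => Config i.+1 r (upd m (r a) (r s))
  | Jump l    => Config l r m
  | Jzero a l => Config (if r a == 0 then l else i.+1) r m
  | Halt      => c
  end.

Definition halted (p : program) (c : config) : Prop := current p c = Halt.

(* The input word occupies the first cells; everything else is 0. *)
Definition initial (w : seq nat) : config :=
  Config 0 (fun=> 0) (fun i => nth 0 w i).

(* Started on w, p stops after at most t steps with answer b in register 0. *)
Definition answers_within (p : program) (w : seq nat) (t : nat) (b : bool) :
    Prop :=
  exists2 t', t' <= t &
    halted p (iter t' (step p) (initial w)) /\
    reg (iter t' (step p) (initial w)) 0 = b.

(* s lists each member of B exactly once, and each member is given as a list of
   its elements without repetition; both orders are arbitrary. *)
Definition lists_family (s : seq (seq nat)) (B : {fset {fset nat}}) : Prop :=
  all uniq s /\ perm_eq [seq [fset x in l] | l <- s] B.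

(* Number of sets, then each set as its cardinality followed by its elements. *)
Definition encode_family (s : seq (seq nat)) : seq nat :=
  size s :: flatten [seq size l :: l | l <- s].

Definition total_size (B : {fset {fset nat}}) : nat := \sum_(S <- B) #|` S|.

(* Main.v *)
Require Import Defs.
From HB Require Import structures.
From mathcomp Require Import all_boot.
From mathcomp Require Import finmap.
From mathcomp Require Import zify.

Set Implicit Arguments.
Unset Strict Implicit.
Unset Printing Implicit Defensive.

(* B is the base of a learning space exactly when it contains the empty set and
   every nonempty S in B has exactly one element outside the union U(S) of the
   members of B strictly inside S. At least one, for otherwise S is redundant in
   B; at most one, because a tight path from S to the empty set starts with some
   S - x in the span, and S - x is then included in U(S). Conversely, if
   U(S) = S - x for every such S, then for P and R in the span with R not inside
   P, a smallest T in B with T inside R but not inside P has a single element x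
   outside P, so that P + x = P U T is in the span; such steps, applied towards
   Q from P or towards P from Q, build a tight path from P to Q.

   The machine checks this directly: for each S it stamps the elements of S, and
   for each smaller T tests T against the stamps and, if T lies inside S,
   re-stamps the elements of T while counting. This takes time O(n + m) for each
   S, and n <= m + 1 as at most one of the sets is empty. *)

(** * Bases of learning spaces *)

Section BaseCriterion.

Local Open Scope fset_scope.

Variable K : choiceType.
Implicit Types (P Q R S T X : {fset K}) (B F G H : {fset {fset K}}) (x y : K).

(** * Spans and unions *)

Lemma mem_fcover G x : reflect (exists2 T, T \in G & x \in T) (x \in fcover G).
Proof.
rewrite /fcover; apply: (iffP (bigfcupP _ _ _ _)).
  by case=> T /andP[GT _] Tx; exists T.
case=> T GT Tx; exists T => //.
by rewrite GT.
Qed.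

Lemma mem_family_span B X :
  reflect (exists H, [/\ H `<=` B, H != fset0 & X = fcover H])
          (X \in family_span B).
Proof.
apply: (iffP idP) => [/imfsetP[H /= /andP[BH H0] ->]|[H [HB H0 ->]]].
  by exists H; rewrite -fpowersetE.
by apply/imfsetP; exists H; rewrite //= inE /= fpowersetE HB H0.
Qed.

Lemma family_span_sub B : B `<=` family_span B.
Proof.
apply/fsubsetP => S BS; apply/mem_family_span; exists [fset S]; split.
- by rewrite fsub1set.
- by apply/fset0Pn; exists S; rewrite inE.
- by rewrite /fcover big_seq_fset1.
Qed.

(** The members of [B] inside [X] form the largest candidate subfamily, and [fset0] keeps it
    nonempty. *)
Lemma family_spanP B X : fset0 \in B ->
  reflect (forall x, x \in X -> exists T, [/\ T \in B, T `<=` X & x \in T])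
          (X \in family_span B).
Proof.
move=> B0; apply: (iffP (mem_family_span B X)) => [[H [HB _ ->]] x|inX].
  case/mem_fcover => T HT Tx; exists T; split=> //; first exact: (fsubsetP HB).
  by apply/fsubsetP => y Ty; apply/mem_fcover; exists T.
exists [fset T in B | T `<=` X]; split.
- by apply/fsubsetP => T; rewrite !inE => /andP[].
- by apply/fset0Pn; exists fset0; rewrite !inE B0 fsub0set.
apply/fsetP => x; apply/idP/mem_fcover => [/inX[T [BT TX Tx]]|[T]].
  by exists T; rewrite // !inE BT.
by rewrite !inE => /andP[_ /fsubsetP]; apply.
Qed.

Lemma family_span_closed B : fset0 \in B -> union_closed (family_span B).
Proof.
move=> B0 G /fsubsetP GF _; apply/family_spanP => // x /mem_fcover[Y GY Yx].
have [T [BT TY Tx]] := family_spanP _ B0 (GF _ GY) _ Yx.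
exists T; split=> //; apply: fsubset_trans TY _.
by apply/fsubsetP => y Yy; apply/mem_fcover; exists Y.
Qed.

Lemma fset0_span B : (fset0 \in family_span B) = (fset0 \in B).
Proof.
apply/idP/idP => [/mem_family_span[H [HB /fset0Pn[T HT] eH]]|].
  suff <- : T = fset0 by exact: (fsubsetP HB).
  by apply/eqP; rewrite -fsubset0 eH; apply/fsubsetP => x Tx;
    apply/mem_fcover; exists T.
exact/fsubsetP/family_span_sub.
Qed.

(** * Distances and tight paths *)

Lemma set_dist_sym P Q : set_dist P Q = set_dist Q P.
Proof. by rewrite /set_dist fsetUC. Qed.

Lemma leq_card_dist P Q : #|` P| <= #|` Q| + set_dist P Q.
Proof.
rewrite (leq_trans _ (leq_card_fsetU Q _).1) // fsubset_leq_card //.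
by apply/fsubsetP => x; rewrite !inE => ->; case: (x \in Q).
Qed.

Lemma leq_card_path P ps :
  path (fun X Y => set_dist X Y == 1) P ps -> #|` P| <= #|` last P ps| + size ps.
Proof.
elim: ps P => [|Q ps IH] P /=; first by rewrite addn0.
by case/andP=> /eqP PQ /IH; have := leq_card_dist P Q; lia.
Qed.

Lemma set_dist0 P : set_dist P fset0 = #|` P|.
Proof. by rewrite /set_dist fsetD0 fset0D fsetU0. Qed.

Lemma set_dist_step P Q x : x \in Q -> x \notin P ->
  set_dist P Q = (set_dist (x |` P) Q).+1.
Proof.
move=> Qx Px; rewrite /set_dist (cardfsD1 x) !inE Px Qx /=.
congr (#|` _|.+1); apply/fsetP => y; rewrite !inE.
by case: (y =P x) => [->|]; rewrite ?Qx //= ?andbF.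
Qed.

Lemma set_dist_fsetU1 P x : x \notin P -> set_dist P (x |` P) = 1.
Proof.
move=> Px; rewrite (@set_dist_step _ _ x) ?fset1U1 //.
by rewrite /set_dist !fsetDv fsetU0 cardfs0.
Qed.

(** The path to [fset0] has as many steps as [S] has elements, and each step lowers the cardinality
    by at most one; so the first step must remove an element. *)
Lemma well_graded_down {F S} : well_graded F -> fset0 \in F -> S \in F ->
  S != fset0 -> exists2 x, x \in S & S `\ x \in F.
Proof.
move=> wgF F0 FS S0; have [ps [psF lastps sizeps]] := wgF _ _ FS F0 S0.
case: ps => [|X ps] /= in psF lastps sizeps *.
  by rewrite lastps eqxx in S0.
case/andP=> /eqP dX /leq_card_path; rewrite lastps cardfs0 add0n => leX.
rewrite set_dist0 in sizeps.
have FX : X \in F by apply: psF; rewrite !inE eqxx orbT.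
have /cardfs1P[x eqD] := introT eqP dX.
have inD y : (y \in S) (+) (y \in X) = (y == x).
  by rewrite -in_fset1 -eqD !inE; do 2!case: (_ \in _).
have Sx : x \in S.
  apply: contraT => nSx; suff /fsubset_leq_card : S `<=` X by lia.
  apply/fsubsetP => y Sy; have := inD y; rewrite Sy.
  by case: (y =P x) => [yx|_]; [rewrite -yx Sy in nSx | case: (y \in X)].
exists x => //; suff -> : S `\ x = X by [].
apply/fsetP => y; rewrite !inE -(inD y); have := inD y.
case: (y =P x) => [->|_]; first by rewrite Sx; case: (x \in X).
by do 2!case: (_ \in _).
Qed.

Definition uncovered B S : {fset K} :=
  S `\` fcover [fset T in B | T `<` S].

Lemma uncoveredP B S x :
  reflect (x \in S /\ forall T, T \in B -> T `<` S -> x \notin T)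
          (x \in uncovered B S).
Proof.
rewrite in_fsetD andbC; apply: (iffP andP) => -[Sx cov]; split=> //.
  move=> T BT TS; apply: contra cov => Tx; apply/mem_fcover; exists T => //.
  by rewrite !inE BT.
apply/mem_fcover => -[T]; rewrite !inE => /andP[BT TS].
exact/negP/cov.
Qed.

(** Wherever [S] serves to cover a point, a member strictly inside [S] covers it as well. *)
Lemma uncovered0_redundant B S : fset0 \in B -> S != fset0 ->
  uncovered B S = fset0 -> family_span (B `\ S) = family_span B.
Proof.
move=> B0 S0 U0; have B'0 : fset0 \in B `\ S by rewrite !inE eq_sym S0.
apply/fsetP => X; apply/family_spanP/family_spanP => // inX x /inX[T].
  by case; rewrite !inE => /andP[_ BT] TX Tx; exists T.
case=> BT TX Tx; have [eTS|nTS] := eqVneq T S; last first.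
  by exists T; rewrite !inE nTS.
have : x \notin uncovered B S by rewrite U0 inE.
rewrite in_fsetD -eTS Tx andbT negbK => /mem_fcover[T']; rewrite !inE.
case/andP=> BT' T'T T'x; exists T'; split=> //.
  by rewrite !inE BT' fproper_neq.
exact: fsubset_trans (fproper_sub T'T) TX.
Qed.

Section Sufficiency.

Variable B : {fset {fset K}}.
Hypothesis B0 : fset0 \in B.
Hypothesis B1 : forall S, S \in B -> S != fset0 -> #|` uncovered B S| = 1.
Let F := family_span B.

Lemma span_grow P R : P \in F -> R \in F -> ~~ (R `<=` P) ->
  exists x, [/\ x \in R, x \notin P & x |` P \in F].
Proof.
move=> FP FR /fsubsetPn[z Rz Pz].
have [T [BT TR Tz]] := family_spanP _ B0 FR _ Rz.
have {z Rz Pz Tz} TP : ~~ (T `<=` P) by apply/fsubsetPn; exists z.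
have [n leTn] := ubnP #|` T|.
elim: n T leTn BT TR TP => // n IH T leTn BT TR TP.
(* Descend to a smaller [T'] that is still not inside [P], unless [T] is already minimal. *)
have [[T' [BT' T'T T'P]]|noT'] :
    (exists T', [/\ T' \in B, T' `<` T & ~~ (T' `<=` P)]) \/
    (forall T', T' \in B -> T' `<` T -> T' `<=` P).
- have [e0|/fset0Pn[T']] :=
      eqVneq [fset T' in B | (T' `<` T) && ~~ (T' `<=` P)] fset0; last first.
    by rewrite !inE => /and3P[*]; left; exists T'.
  right=> T' BT' T'T; apply: contraT => T'P.
  by have := in_fset0 T'; rewrite -e0 !inE BT' T'T T'P.
- apply: (IH T') => //; first by have := fproper_ltn_card T'T; lia.
  exact: fsubset_trans (fproper_sub T'T) TR.
have T0 : T != fset0 by apply: contraNneq TP => ->; rewrite fsub0set.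
have /eqP/cardfs1P[x eqU] := B1 BT T0.
have inP y : y \in T -> y != x -> y \in P.
  move=> Ty yx; have : y \notin uncovered B T by rewrite eqU inE.
  rewrite in_fsetD Ty andbT negbK => /mem_fcover[T'].
  rewrite !inE => /andP[BT' T'T].
  exact/fsubsetP/noT'.
have Tx : x \in T by have := fset11 x; rewrite -eqU => /uncoveredP[].
have Px : x \notin P.
  apply: contra TP => Px; apply/fsubsetP => y Ty.
  by have [->|] := eqVneq y x; last exact: inP.
exists x; split=> //; first exact: (fsubsetP TR).
apply/family_spanP => // y; rewrite !inE => /orP[/eqP->|Py].
  exists T; split=> //; apply/fsubsetP => t Tt; rewrite !inE.
  by case: eqVneq => //= /(inP _ Tt).
have [T' [BT' T'P T'y]] := family_spanP _ B0 FP _ Py.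
exists T'; split=> //; apply: fsubset_trans T'P _; exact: fsubsetUr.
Qed.

Lemma span_well_graded : well_graded F.
Proof.
move=> P Q FP FQ _; have [n] := ubnP (set_dist P Q).
elim: n P Q FP FQ => // n IH P Q FP FQ ledn.
have [QP|/(span_grow FP FQ)[x [Qx Px FPx]]] := boolP (Q `<=` P); last first.
  have dPQ := set_dist_step Qx Px.
  have [|ps [psF lastps sizeps pathps]] := IH _ _ FPx FQ; first by lia.
  exists ((x |` P) :: ps); split=> //=.
  - by move=> Y; rewrite inE => /predU1P[->|/psF].
  - by rewrite sizeps dPQ.
  - by rewrite set_dist_fsetU1.
(* Now [Q] lies inside [P]: grow [Q] towards [P] and put the old [Q] at the end of the path. *)
have [PQ|/(span_grow FQ FP)[x [Px Qx FQx]]] := boolP (P `<=` Q).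
  have -> : P = Q by apply/eqP; rewrite eqEfsubset PQ.
  exists [::]; split=> //; first by move=> Y; rewrite inE => /eqP->.
  by rewrite /set_dist !fsetDv fsetU0 cardfs0.
have dPQ := set_dist_step Px Qx; rewrite ![set_dist _ P]set_dist_sym in dPQ.
have [|ps [psF lastps sizeps pathps]] := IH _ _ FP FQx; first by lia.
exists (rcons ps Q); split.
- by move=> Y; rewrite -rcons_cons mem_rcons inE => /predU1P[->|/psF].
- exact: last_rcons.
- by rewrite size_rcons sizeps dPQ.
- by rewrite rcons_path pathps lastps set_dist_sym set_dist_fsetU1.
Qed.

(** The uncovered point of a nonempty [S] lies in no member strictly inside [S], so a spanning
    subfamily of [B] must contain [S]. *)
Lemma span_base : is_base B F.
Proof.
split=> [||G _ spanG GB]; [exact: family_span_sub | by [] |].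
apply/eqP; rewrite eqEfsubset GB; apply/fsubsetP => S BS.
have : S \in family_span G by rewrite spanG (fsubsetP (family_span_sub B)).
have [-> |S0] := eqVneq S fset0; first by rewrite fset0_span.
case/mem_family_span=> H [HG _ eqS].
have /eqP/cardfs1P[x eqU] := B1 BS S0.
have /uncoveredP[Sx ncov] : x \in uncovered B S by rewrite eqU inE.
have: x \in fcover H by rewrite -eqS.
case/mem_fcover=> T HT Tx; have GT := fsubsetP HG T HT.
have TS : T `<=` S.
  by apply/fsubsetP => y Ty; rewrite eqS; apply/mem_fcover; exists T.
case: (eqVfproper TS) => [<- //|/(ncov _ (fsubsetP GB _ GT))].
by rewrite Tx.
Qed.

End Sufficiency.

Theorem base_of_learning_spaceP B :
  base_of_learning_space B <->
  fset0 \in B /\ forall S, S \in B -> S != fset0 -> #|` uncovered B S| = 1.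
Proof.
split=> [[F [wgF ucF F0] [BF spanB minB]]|[B0 B1]]; last first.
  exists (family_span B); last exact: span_base.
  split; [exact: span_well_graded | exact: family_span_closed |].
  by rewrite fset0_span.
have B0 : fset0 \in B by rewrite -fset0_span spanB.
split=> // S BS S0; have FS := fsubsetP BF S BS.
have [x Sx FSx] := well_graded_down wgF F0 FS S0.
have subU : uncovered B S `<=` [fset x].
  apply/fsubsetP => y /uncoveredP[Sy ncov]; rewrite inE.
  apply: contraT => yx; rewrite -spanB in FSx.
  have Sxy : y \in S `\ x by rewrite !inE yx.
  have [T [BT TS]] := family_spanP _ B0 FSx _ Sxy.
  by rewrite (negPf (ncov T BT (fsub_proper_trans TS (fproperD1 Sx)))).
apply/eqP; rewrite eqn_leq (leq_trans (fsubset_leq_card subU)) ?cardfs1 //=.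
rewrite cardfs_gt0; apply/eqP => /(uncovered0_redundant B0 S0).
rewrite spanB => /minB eqB; have : S \in B `\ S.
  by rewrite eqB ?fsubD1set // (fsubset_trans (fsubD1set _ _) BF).
by rewrite !inE eqxx.
Qed.

End BaseCriterion.

(** * The decision program *)

Local Notation Sub := Defs.Sub.

(* Registers:
   0  whether the empty set has been met, reset to 0 on rejection;
   1  the constant 1;
   2  the input length n: the cell of an element x is n + x;
   3  address of the block of the current set S, 4 its cardinality,
   5  number of elements of S not covered yet;
   6  address of the block of the set T compared with S, 7 its cardinality;
   8  address of the next element in a scan, 9 elements left;
   10, 11  scratch.
   The comments number the jump targets. *)
Definition decider : program := [::
  Const 1 1;
  Const 2 1;
  Read 9 10;
  (* 3: input length *) Jzero 9 9;
  Read 10 2;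
  Add 2 2 10;
  Add 2 2 1;
  Sub 9 9 1;
  Jump 3;
  Const 3 1;
  (* 10: next S *) Sub 10 2 3;
  Jzero 10 62;
  Read 4 3;
  Jzero 4 63;
  Add 8 3 1;
  Read 9 3;
  (* 16: mark S *) Jzero 9 23;
  Read 10 8;
  Add 10 2 10;
  Write 10 3;
  Add 8 8 1;
  Sub 9 9 1;
  Jump 16;
  (* 23 *) Read 5 3;
  Const 6 1;
  (* 25: next T *) Sub 10 2 6;
  Jzero 10 58;
  Read 7 6;
  Sub 10 4 7;
  Jzero 10 55;
  Add 8 6 1;
  Read 9 6;
  (* 32: is T inside S? *) Jzero 9 41;
  Read 10 8;
  Add 10 2 10;
  Read 10 10;
  Sub 10 3 10;
  Add 8 8 1;
  Sub 9 9 1;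
  Jzero 10 32;
  Jump 55;
  (* 41 *) Add 8 6 1;
  Read 9 6;
  (* 43: cover T *) Jzero 9 55;
  Read 10 8;
  Add 10 2 10;
  Read 11 10;
  Sub 11 11 3;
  Sub 11 1 11;
  Sub 5 5 11;
  Add 11 3 1;
  Write 10 11;
  Add 8 8 1;
  Sub 9 9 1;
  Jump 43;
  (* 55 *) Add 6 6 7;
  Add 6 6 1;
  Jump 25;
  (* 58: exactly one uncovered? *) Jzero 5 61;
  Sub 5 5 1;
  Jzero 5 64;
  (* 61 *) Const 0 0;
  (* 62 *) Halt;
  (* 63 *) Const 0 1;
  (* 64 *) Add 3 3 4;
  Add 3 3 1;
  Jump 10
].

(** * Runs within a time budget *)

Implicit Types (m : nat -> nat) (S T l : seq nat) (s : seq (seq nat)).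
Implicit Types (Q : config -> Prop).

(** The loop lemmas are in continuation form: a budget [u] for the code after a loop yields a budget
    [t] for the loop and that code together. *)
Definition within t (c : config) Q : Prop :=
  exists2 t', t' <= t & Q (iter t' (step decider) c).

Lemma within_leq t t' c Q : t' <= t -> within t' c Q -> within t c Q.
Proof. by move=> le_t [u le_u Qu]; exists u => //; apply: leq_trans le_t. Qed.

Lemma within_steps k t c Q :
  k <= t -> within (t - k) (iter k (step decider) c) Q -> within t c Q.
Proof. by move=> le_k [u le_u Qu]; exists (u + k); [lia | rewrite iterD]. Qed.

(* regs lists the contents of the first registers; the others are arbitrary. *)
Definition from i regs m t Q : Prop :=
  forall r, mkseq r (size regs) = regs -> within t (Config i r m) Q.

Lemma updE f a v i : upd f a v i = if i == a then v else f i.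
Proof. by []. Qed.

Ltac exec k :=
  apply: (@within_steps k); [lia | rewrite /= ?updE /=].

Definition stores m a l : Prop :=
  forall i, i < size l -> m (a + i) = nth 0 l i.

Lemma stores_cons m a x l :
  stores m a (x :: l) -> m a = x /\ stores m (a + 1) l.
Proof.
move=> ml; split=> [|i lt_i]; first by rewrite -[a]addn0 ml.
by rewrite -addnA add1n ml.
Qed.

Lemma stores_cat m a l l' :
  stores m a (l ++ l') -> stores m a l /\ stores m (a + size l) l'.
Proof.
move=> ml; split=> i lt_i.
  by rewrite ml ?nth_cat ?lt_i // size_cat ltn_addr.
by rewrite -addnA ml ?nth_cat ?size_cat ?ltn_add2l // ltnNge leq_addr addKn.
Qed.

(** The program writes only to cells from [n] on, so the input below [n] survives. *)
Lemma stores_frame n m m' a l : {in gtn n, m' =1 m} -> a + size l <= n ->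
  stores m a l -> stores m' a l.
Proof.
by move=> eq_m le_n ml i lt_i; rewrite eq_m ?ml // inE; lia.
Qed.

(* The stamp p is the address of the block of S. As S is nonempty, the next
   block starts beyond p + 1, so the stamps left by earlier sets are all below
   the current one and the cells never have to be cleared. *)
Definition marked m n p S (C : seq nat) : Prop :=
  forall x, if x \in S then m (n + x) = p + (x \in C) else m (n + x) < p.


Ltac regs := rewrite /mkseq /= ?updE /= ?subn1 /=; congruence.

(** * The loops of the program *)

Lemma upd_frame m n x v : {in gtn n, upd m (n + x) v =1 m}.
Proof. by move=> i; rewrite inE updE; case: eqP => //; lia. Qed.

Lemma frame_trans n m1 m2 m3 :
  {in gtn n, m2 =1 m1} -> {in gtn n, m3 =1 m2} -> {in gtn n, m3 =1 m1}.
Proof. by move=> eq12 eq23 i lt_i; rewrite eq23 ?eq12. Qed.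

(** Here [S] is the part already stamped and [l] the rest; an element costs 7 instructions. *)
Lemma mark_loop b n p k rem q h j l m S t u Q :
    j + size l <= n -> stores m j l -> marked m n p S [::] ->
    7 * size l + 1 + u <= t ->
    (forall m', {in gtn n, m' =1 m} -> marked m' n p (S ++ l) [::] ->
       from 23 [:: b; 1; n; p; k; rem; q; h] m' u Q) ->
  from 16 [:: b; 1; n; p; k; rem; q; h; j; size l] m t Q.
Proof.
elim: l => [|x l IH] in j m S t *; move=> /= le_n ml mS le_t post r [];
  move=> r0 r1 r2 r3 r4 r5 r6 r7 r8 r9; exec 1; rewrite r9 /=.
  apply: within_leq (post m _ _ _ _); rewrite ?cats0 //; first by lia.
  by regs.
have [mj ml'] := stores_cons ml.
exec 3; exec 3; rewrite r9 r8 r1 r2 r3 mj.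
have eq_m := @upd_frame m n x p.
apply: (IH (j + 1) _ (rcons S x)); [lia | | | lia | | by regs].
- by apply: stores_frame ml'; [exact: eq_m | lia].
- move=> y; rewrite updE eqn_add2l mem_rcons inE; have := mS y.
  by case: eqP => //=; rewrite addn0.
- by move=> m' /(frame_trans eq_m) eq_m'; rewrite cat_rcons; exact: post.
Qed.

(** Truncated subtraction of a stamp from [p] gives 0 exactly when the stamp is at least [p], that
    is, when the element is in [S]. *)
Lemma subset_loop b n p k rem q h j l m S C t u Q :
    stores m j l -> marked m n p S C -> 8 * size l + 1 + u <= t ->
    from (if all [in S] l then 41 else 55)
      [:: b; 1; n; p; k; rem; q; h] m u Q ->
  from 32 [:: b; 1; n; p; k; rem; q; h; j; size l] m t Q.
Proof.
elim: l => [|x l IH] in j t *; move=> /= ml mS le_t post r [];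
  move=> r0 r1 r2 r3 r4 r5 r6 r7 r8 r9; exec 1; rewrite r9 /=.
  by apply: within_leq (post _ _); [lia | regs].
have [mj ml'] := stores_cons ml.
exec 4; exec 3; rewrite r9 r8 r1 r2 r3 mj; have := mS x.
case: (x \in S) post => /= post mx.
  rewrite mx subnDA subnn /=.
  by apply: (IH (j + 1)); [ | | lia | | regs].
case: eqP => [|_]; first by lia.
by exec 1; apply: within_leq (post _ _); [lia | regs].
Qed.

(** The left side is the update made by the program, which finds [x \in C] as the stamp minus
    [p]. *)
Lemma count_notin_rcons (S C : seq nat) x : uniq S -> x \in S ->
  count [predC C] S - (1 - (x \in C)) = count [predC rcons C x] S.
Proof.
move=> uS Sx; have [Cx|nCx] := boolP (x \in C).
  rewrite subn0; apply: eq_count => y; rewrite /= mem_rcons inE.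
  by case: eqP => [->|]; rewrite ?Cx.
have /permP eqS := perm_to_rem Sx.
rewrite !eqS /= nCx mem_rcons mem_head add0n addKn.
apply: eq_in_count => y; rewrite mem_rem_uniq // inE => /andP[yx _] /=.
by rewrite mem_rcons inE (negPf yx).
Qed.

Lemma cover_loop b n p k q h j l m S C t u Q :
    uniq S -> {subset l <= S} ->
    j + size l <= n -> stores m j l -> marked m n p S C ->
    12 * size l + 1 + u <= t ->
    (forall m', {in gtn n, m' =1 m} -> marked m' n p S (C ++ l) ->
       from 55 [:: b; 1; n; p; k; count [predC C ++ l] S; q; h] m' u Q) ->
  from 43 [:: b; 1; n; p; k; count [predC C] S; q; h; j; size l] m t Q.
Proof.
move=> uS; elim: l => [|x l IH] in j m C t *;
  move=> /= lS le_n ml mS le_t post r [];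
  move=> r0 r1 r2 r3 r4 r5 r6 r7 r8 r9; exec 1; rewrite r9 /=.
  by apply: within_leq (post m _ _ _ _); rewrite ?cats0 //; [lia | regs].
have [mj ml'] := stores_cons ml.
have Sx : x \in S by apply: lS; rewrite inE eqxx.
have mx : m (n + x) = p + (x \in C) by have := mS x; rewrite Sx.
exec 4; exec 4; exec 3.
rewrite r9 r8 r1 r2 r3 r5 mj mx addKn count_notin_rcons //.
have eq_m := @upd_frame m n x (p + 1).
apply: (IH (j + 1) _ (rcons C x)); [ | lia | | | lia | | by regs].
- by move=> y ly; apply: lS; rewrite inE ly orbT.
- by apply: stores_frame ml'; [exact: eq_m | lia].
- move=> y; rewrite updE eqn_add2l mem_rcons inE; have := mS y.
  by case: eqP => // ->; rewrite Sx.
- by move=> m' /(frame_trans eq_m) eq_m'; rewrite cat_rcons; exact: post.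
Qed.

(** On duplicate-free lists this is strict inclusion, in the form the program tests. *)
Definition below s S : seq (seq nat) :=
  [seq T <- s | (size T < size S) && all [in S] T].

(** The encoded input without its leading number of sets. *)
Definition blocks s : seq nat := flatten [seq size l :: l | l <- s].
Arguments blocks : simpl never.

Lemma blocks_cons T s : blocks (T :: s) = size T :: T ++ blocks s.
Proof. by []. Qed.

(** For each [T], the inclusion test costs 8 and the covering 12 per element; the 20 for the size
    cell pays for the at most 14 other instructions. *)
Lemma sets_loop b n p q m s S C t u Q :
    uniq S -> q + size (blocks s) = n -> stores m q (blocks s) ->
    marked m n p S C -> 20 * size (blocks s) + 2 + u <= t ->
    (forall m', {in gtn n, m' =1 m} ->
       marked m' n p S (C ++ flatten (below s S)) ->
       from 58
         [:: b; 1; n; p; size S; count [predC C ++ flatten (below s S)] S]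
         m' u Q) ->
  from 25 [:: b; 1; n; p; size S; count [predC C] S; q] m t Q.
Proof.
move=> uS; elim: s => [|T s IH] in q m C t *;
  rewrite ?blocks_cons /= => le_n ms mS le_t post r [];
  move=> r0 r1 r2 r3 r4 r5 r6.
  exec 2; rewrite r2 r6 -le_n addn0 subnn /=.
  by apply: within_leq (post m _ _ _ _); rewrite ?cats0 //; [lia | regs].
have [mq /stores_cat[mT ms']] := stores_cons ms; rewrite size_cat in le_n le_t.
exec 2; rewrite r2 r6; case: eqP => [|_]; first by lia.
(* Three ways lead to 55: [T] is not smaller than [S], is not inside [S], or has just been
   covered. *)
have next m' t' C' : {in gtn n, m' =1 m} -> marked m' n p S C' ->
    20 * size (blocks s) + 5 + u <= t' ->
    C' ++ flatten (below s S) = C ++ flatten (below (T :: s) S) ->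
    from 55 [:: b; 1; n; p; size S; count [predC C'] S; q; size T] m' t' Q.
  move=> eq_m' mS' le_t' eqC r' [].
  move=> {}r0 {}r1 {}r2 {}r3 {}r4 {}r5 {}r6 r7.
  exec 3; rewrite r1 r6 r7; apply: (IH (q + 1 + size T)); first by lia.
  - by apply: stores_frame ms'; [exact: eq_m' | lia].
  - exact: mS'.
  - lia.
  - by rewrite eqC => m'' /(frame_trans eq_m'); exact: post.
  - by rewrite [q + 1 + _]addnAC; regs.
exec 3; rewrite r6 mq r4 subn_eq0 leqNgt.
case: ltnP => /= ltTS; last first.
  apply: (next m _ C) => //; [lia | | by regs].
  by rewrite /= ltnNge ltTS.
exec 2; rewrite r6 mq r1.
apply: (subset_loop (h := size T)
  (u := t - 2 - 3 - 2 - (8 * size T + 1)) mT mS).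
- lia.
- case: ifP => sTS; last first.
    by apply: (next m _ C) => //=; [lia | rewrite ltTS sTS].
  move=> r' []; move=> {}r0 {}r1 {}r2 {}r3 {}r4 {}r5 {}r6 r7.
  exec 2; rewrite r6 mq r1.
  apply: (cover_loop (h := size T)
    (u := 20 * size (blocks s) + 5 + u) uS _ _ mT mS).
  + exact/allP.
  + lia.
  + lia.
  + move=> m' eq_m' mS'; apply: next => //.
    by rewrite /= ltTS sTS /= catA.
  + by regs.
- by regs.
Qed.

Definition good s S : bool :=
  (S == [::]) || (count [predC flatten (below s S)] S == 1).

Definition final (b : bool) (c : config) : Prop :=
  halted decider c /\ reg c 0 = b.

(** Here [s'] is the part of the input [s] still to be checked, and [b] tells whether the empty set
    came before it. *)
Lemma main_loop n p m s s' t (b : bool) :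
    0 < p -> 1 + size (blocks s) = n -> stores m 1 (blocks s) ->
    p + size (blocks s') = n -> stores m p (blocks s') -> all uniq s' ->
    (forall x, m (n + x) < p) ->
    7 * size (blocks s') + (20 * size (blocks s) + 20) * size s' + 2 <= t ->
  from 10 [:: b : nat; 1; n; p] m t
    (final ((b || ([::] \in s')) && all (good s) s')).
Proof.
move=> + def_n ms; elim: s' => [|S s' IH] in p m t b ms *;
  rewrite ?blocks_cons /= => p_gt0 le_n ms' us lt_p le_t r [];
  move=> r0 r1 r2 r3.
  exec 2; rewrite r2 r3 -le_n addn0 subnn /=.
  by exists 0 => //; split; rewrite ?orbF ?andbT.
have [mp /stores_cat[mS {}ms']] := stores_cons ms'.
rewrite size_cat mulnS in le_n le_t; case/andP: us => uS us.
exec 2; rewrite r2 r3; case: eqP => [|_]; first by lia.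
exec 2; rewrite r3 mp.
(* An empty [S] and a nonempty one that passes the test both go on to the next block from 64. *)
have adv (c : bool) m' t' :
    7 * size (blocks s') + (20 * size (blocks s) + 20) * size s' + 5 <= t' ->
    {in gtn n, m' =1 m} -> (forall x, m' (n + x) < p + 1 + size S) ->
    from 64 [:: c : nat; 1; n; p; size S] m' t'
      (final ((c || ([::] \in s')) && all (good s) s')).
  move=> le_t' eq_m' lt_p' r' []; move=> {}r0 {}r1 {}r2 {}r3 r4.
  exec 3; rewrite r1 r3 r4.
  apply: (IH (p + 1 + size S)); rewrite ?addn_gt0 ?p_gt0 //.
  - by apply: stores_frame ms; [exact: eq_m' | lia].
  - lia.
  - by apply: stores_frame ms'; [exact: eq_m' | lia].
  - lia.
  - by rewrite [p + 1 + _]addnAC; regs.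
have [eS|nS] := eqVneq S [::].
  rewrite eS /= in adv le_t *; exec 1; rewrite inE eqxx orbT.
  apply: (adv true) => //; [lia | | by regs].
  by move=> x; have := lt_p x; lia.
rewrite [_ \in S :: _]inE [_ == S]eq_sym (negPf nS) /=.
have S_gt0 : 0 < size S by rewrite lt0n size_eq0.
rewrite eqn0Ngt S_gt0 /=; exec 2; rewrite r1 r3 mp.
apply: (mark_loop (b := b) (n := n) (p := p) (k := size S)
  (rem := r 5) (q := r 6) (h := r 7) (S := [::])
  (u := 7 * size (blocks s') + (20 * size (blocks s) + 20) * size s' +
        20 * size (blocks s) + 12) _ mS).
- lia.
- by move=> y; exact: lt_p.
- lia.
- move=> m1 eq_m1 mS1 r' [].
  move=> {}r0 {}r1 {}r2 {}r3 {}r4 {}r5 {}r6 {}r7.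
  have m1p : m1 p = size S by rewrite eq_m1 // inE; lia.
  exec 2; rewrite r3 m1p.
  apply: (@sets_loop b n p 1 m1 s S [::] _
    (7 * size (blocks s') + (20 * size (blocks s) + 20) * size s' + 8)) => //.
  + by apply: stores_frame ms; [exact: eq_m1 | lia].
  + lia.
  + move=> m2 eq_m2 mS2 r'' [].
    move=> {}r0 {}r1 {}r2 {}r3 {}r4 {}r5.
    have reject m' q t' : 2 <= t' ->
        within t' (Config 61 q m') (final false).
      by move=> le_t'; exec 1; exists 0.
    have -> : good s S = (count [predC flatten (below s S)] S == 1).
      by rewrite /good (negPf nS).
    move: (count _ S) => c /= in r5 *.
    exec 1; rewrite r5; case: c r5 => [|c] r5 /=.
      by rewrite andbF; apply: reject; lia.
    exec 2; rewrite r1 r5 subn1 /=; case: c r5 => [|c] r5 /=; last first.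
      by rewrite andbF; apply: reject; lia.
    apply: (adv b) => //; [lia | | | ].
    + by apply: frame_trans eq_m2.
    + by move=> y; have := mS2 y; case: ifP => _; lia.
    + by regs.
  + have -> : count [predC [::]] S = size S.
      by rewrite -count_predT; apply: eq_count.
    by regs.
- by regs.
Qed.

(** Only the size cells are read, at 6 instructions per set; skipping from block to block ends at
    the first address beyond the input. *)
Lemma scan_loop q c3 c4 c5 c6 c7 c8 m s t u Q :
    stores m q (blocks s) -> 6 * size s + 2 + u <= t ->
    from 10 [:: 0; 1; q + size (blocks s); 1] m u Q ->
  from 3 [:: 0; 1; q; c3; c4; c5; c6; c7; c8; size s] m t Q.
Proof.
elim: s => [|T s IH] in q t *;
  rewrite ?blocks_cons /= => ms le_t post r [];
  move=> r0 r1 r2 r3 r4 r5 r6 r7 r8 r9; exec 1; rewrite r9 /=.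
  exec 1; apply: within_leq (post _ _); first by lia.
  by rewrite addn0; regs.
have [mq /stores_cat[_ ms']] := stores_cons ms.
exec 5; rewrite r9 r1 r2 mq.
apply: (IH (q + 1 + size T)) => //; first by lia.
  by move: post; rewrite size_cat -addnA -addnA add1n addnS.
by rewrite [q + 1 + _]addnAC; regs.
Qed.

Lemma decider_run s t :
    all uniq s ->
    7 * size (blocks s) + (20 * size (blocks s) + 26) * size s + 7 <= t ->
  within t (initial (encode_family s))
    (final (([::] \in s) && all (good s) s)).
Proof.
move=> us le_t; have /stores_cons[m0 ms] :
  stores (nth 0 (encode_family s)) 0 (size s :: blocks s) by [].
exec 3; apply: (@scan_loop 1 0 0 0 0 0 0 _ s _
  (7 * size (blocks s) + (20 * size (blocks s) + 20) * size s + 2)) => //.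
  by lia.
apply: (@main_loop _ 1 _ s s _ false) => //.
(* Memory beyond the input is 0, below the first stamp 1. *)
by move=> x; rewrite nth_default //= -/(blocks s); lia.
Qed.

Lemma size_blocks s : size (blocks s) = size s + \sum_(l <- s) size l.
Proof.
elim: s => [|l s IH]; rewrite ?big_nil //.
by rewrite blocks_cons big_cons /= size_cat IH; lia.
Qed.

(** Each nonempty list contributes at least 1 to the sum, and [[::]] occurs at most once. *)
Lemma size_uniq_lists s : uniq s -> size s <= (\sum_(l <- s) size l).+1.
Proof.
move=> us; suff: size s <= \sum_(l <- s) size l + ([::] \in s).
  by case: (_ \in s); lia.
elim: s us => // l s IH /= /andP[ls /IH{IH}]; rewrite big_cons inE.
by case: l ls => [/negPf->|x l _] /=; lia.
Qed.

(** * Lists and families *)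

Section Encoding.

Local Open Scope fset_scope.

Variables (B : {fset {fset nat}}) (s : seq (seq nat)).
Hypothesis sB : lists_family s B.

Let us S : S \in s -> uniq S.
Proof. by case: sB => /allP us _; exact: us. Qed.

Lemma mem_lists_family X :
  reflect (exists2 S, S \in s & X = [fset x in S]) (X \in B).
Proof.
by case: sB => _ /perm_mem <-; exact: mapP.
Qed.

Lemma card_fset_uniq S : uniq S -> #|` [fset x in S]| = size S.
Proof. by move=> uS; rewrite card_fseq undup_id. Qed.

Lemma fset_seq_proper S T : S \in s -> T \in s ->
  ([fset x in T] `<` [fset x in S]) = (size T < size S) && all [in S] T.
Proof.
move=> Ss Ts; rewrite fproperEcard !card_fset_uniq ?us // andbC; congr (_ && _).
apply/fsubsetP/allP => TS x; have := TS x; rewrite !inE //=.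
Qed.

(** Links the count kept in register 5 to the criterion for bases. *)
Lemma card_uncovered S : S \in s ->
  #|` uncovered B [fset x in S]| = count [predC flatten (below s S)] S.
Proof.
move=> Ss; rewrite -size_filter -[RHS]card_fset_uniq ?filter_uniq ?us //.
suff -> : uncovered B [fset x in S] =
          [fset x in filter [predC flatten (below s S)] S] by [].
apply/fsetP => x; rewrite [RHS]in_fset /= mem_filter /= andbC.
apply/uncoveredP/andP => [[]|[Sx ncov]].
  rewrite inE /= => Sx ncov; split=> //; apply/flattenP => -[T].
  rewrite mem_filter => /andP[TS sT] Tx.
  have : [fset x in T] \in B by apply/mem_lists_family; exists T.
  by move/ncov; rewrite fset_seq_proper // TS inE /= Tx => /(_ isT).
split=> [|X /mem_lists_family[T sT ->]]; first by rewrite inE.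
rewrite fset_seq_proper // => TS; rewrite inE /=; apply: contra ncov => Tx.
by apply/flattenP; exists T; rewrite // mem_filter TS.
Qed.

Lemma fset_seq_eq0 S : ([fset x in S] == fset0) = (S == [::]).
Proof.
case: S => [|x S]; last by apply/fset0Pn; exists x; rewrite !inE eqxx.
by apply/eqP/fsetP => x; rewrite !inE.
Qed.

Lemma mem_fset0_lists : (fset0 \in B) = ([::] \in s).
Proof.
apply/mem_lists_family/idP => [[S sS /esym/eqP]|s0].
  by rewrite fset_seq_eq0 => /eqP <-.
by exists [::] => //; apply/esym/eqP; rewrite fset_seq_eq0.
Qed.

Lemma decision_correct :
  ([::] \in s) && all (good s) s <-> base_of_learning_space B.
Proof.
rewrite base_of_learning_spaceP -mem_fset0_lists; split.
  case/andP=> B0 /allP gs; split=> // X /mem_lists_family[S sS ->].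
  rewrite fset_seq_eq0 card_uncovered // => /negPf S0.
  by have := gs _ sS; rewrite /good S0 => /eqP.
case=> -> /= B1; apply/allP => S sS; rewrite /good.
have [//|S0] := eqVneq S [::]; rewrite -card_uncovered ?B1 ?fset_seq_eq0 //.
by apply/mem_lists_family; exists S.
Qed.

Lemma card_lists_family : #|` B| = size s.
Proof. by case: sB => _ /perm_size <-; rewrite size_map. Qed.

Lemma total_size_lists : total_size B = \sum_(l <- s) size l.
Proof.
rewrite /total_size -(perm_big _ sB.2) big_map /=.
by apply: eq_big_seq => S /us; exact: card_fset_uniq.
Qed.

Lemma uniq_lists : uniq s.
Proof. by have := perm_uniq sB.2; rewrite fset_uniq; exact: map_uniq. Qed.

End Encoding.

Local Open Scope fset_scope.

Theorem theorem20 :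
  exists (p : program) (C : nat),
    forall (B : {fset {fset nat}}) (s : seq (seq nat)),
      lists_family s B ->
      exists b : bool,
        answers_within p (encode_family s)
          (C * maxn 1 (#|` B| * total_size B)) b /\
        (b <-> base_of_learning_space B).
Proof.
(* The constant is generous: the estimates below give 107 times [n * m] if both are positive, and at
   most 60 if [m = 0]. *)
exists decider, 200 => B s sB; exists (([::] \in s) && all (good s) s).
split; last exact: decision_correct.
apply: decider_run; first by case: sB.
have := size_uniq_lists (uniq_lists sB).
have : size s = 0 -> \sum_(l <- s) size l = 0.
  by move/size0nil->; rewrite big_nil.
rewrite size_blocks (card_lists_family sB) (total_size_lists sB).
move: (size s) (\sum_(l <- s) size l) => n m nil0 le_n.
(* If [m = 0] there is at most one set, and [maxn 1] pays for the constant cost. *)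
have [m0|m_gt0] := posnP m.
  by rewrite m0 in le_n *; case: n le_n {nil0} => [|[|n]]; lia.
have [n0|n_gt0] := posnP n; first by rewrite n0 nil0.
(* Because [n <= m + 1 <= 2 * m]. *)
have le_nn : n * n <= 2 * (n * m) by rewrite mulnCA leq_mul2l; lia.
have := leq_pmulr n m_gt0; have := leq_pmull m n_gt0; lia.
Qed.
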